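(* For every integer $k\ge 1$ there is a constant $c_k$ such that for every oriented tree $T$, $$\mathrm{RT}(T,k)\le c_k|T|^k.$$
   Context: An oriented graph is a directed graph with no loops and at most one edge between any two vertices. An oriented tree is an oriented graph whose underlying undirected graph is a tree; $|T|$ denotes its number of vertices. A tournament is an oriented graph with exactly one edge between every pair of distinct vertices. A $k$-colouring means an edge-colouring with colours $\{1,\dots,k\}$. A copy of $H$ is a (not necessarily induced) subgraph isomorphic to $H$ as a directed graph. The $k$-colour oriented Ramsey number $\mathrm{RT}(H,k)$ of an oriented graph $H$ is the least integer $n$ such that every $k$-coloured tournament on $n$ vertices contains a monochromatic copy of $H$. *)

(* Defs.v *)
From mathcomp Require Import all_boot.
Set Implicit Arguments. Unset Strict Implicit. Unset Printing Implicit Defensive.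

Definition oriented (V : finType) (e : rel V) : Prop :=
  (forall x, ~~ e x x) /\ (forall x y, ~~ (e x y && e y x)).

Definition undirected (V : finType) (e : rel V) : rel V :=
  fun x y => e x y || e y x.

Definition oriented_tree (V : finType) (e : rel V) : Prop :=
  [/\ oriented e,
      0 < #|V|,
      (forall x y, connect (undirected e) x y) &
      (forall c : seq V, 3 <= size c -> ~~ ucycleb (undirected e) c)].

Definition tournament (n : nat) (t : rel 'I_n) : Prop :=
  oriented t /\ (forall x y, x != y -> t x y || t y x).

Definition mono_copy (V : finType) (e : rel V) (n k : nat)
    (t : rel 'I_n) (col : 'I_n -> 'I_n -> 'I_k) : Prop :=
  exists (c : 'I_k) (f : V -> 'I_n), injective f /\
    forall x y, e x y -> t (f x) (f y) /\ col (f x) (f y) = c.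

Definition ramsey_prop (V : finType) (e : rel V) (k n : nat) : Prop :=
  forall (t : rel 'I_n) (col : 'I_n -> 'I_n -> 'I_k),
    tournament t -> mono_copy e t col.

(* RT(H,k) <= m : the least n with ramsey_prop exists and is at most m,
   equivalently some n <= m has ramsey_prop. *)
Definition RT_le (V : finType) (e : rel V) (k m : nat) : Prop :=
  exists n, n <= m /\ ramsey_prop e k n.

(* Main.v *)
Require Import Defs.
From mathcomp Require Import all_boot.
From mathcomp Require Import zify.
Set Implicit Arguments. Unset Strict Implicit. Unset Printing Implicit Defensive.

(** Blow every vertex of a tournament on N vertices up into N twins. Starting
    from the label 0 in nat^k, twins are pushed up one coordinate at a time: for
    each label a, orient the twins carrying it by reversing the edges of every
    colour i with a_i odd, keep a set P of O(kN) twins such that every other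
    twin has about kN out-neighbours in P, and raise each twin outside P in a
    colour in which it has N of them. A multiply dominating set has size linear
    in the multiplicity plus log of the number of twins; after the blow-up that
    logarithm is negligible against N. If no label reaches 4|T| + 2 in some
    coordinate i, there are O(N |T|^k) twins, so N = O(|T|^k). Otherwise T embeds
    in colour i: grow T edge by edge, placing each new vertex at a lower level
    of coordinate i than all earlier ones, where the parity of the level is the
    direction of the edge. A pair of levels is unusable only if N of its twins
    belong to occupied vertices, and there are at most |T| such pairs. *)

(** * Multiple domination in tournaments *)

(** Averaging: if [u] is drawn with probability proportional to [w u], the right-hand side has mean
    exactly the total weight of [E], so some [u] is at least average. *)
Lemma weighted_popular_vertex (W : finType) (D : rel W) (E : {set W})
    (w : W -> nat) :
  (forall x y, x != y -> D x y = ~~ D y x) ->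
  (forall x, 0 < w x) -> 0 < #|E| ->
  exists2 u, u \in E &
    \sum_(x in E) w x <= 2 * (\sum_(x in E | (x != u) && D x u) w x) + w u.
Proof.
move=> Dtot w_gt0 /card_gt0P[u0 u0E].
set S := \sum_(x in E) w x.
pose dom u := \sum_(x in E | (x != u) && D x u) w x.
have domE u : dom u = \sum_(x in E) ((x != u) && D x u) * w x.
  rewrite /dom big_mkcondr /=; apply: eq_bigr => x _.
  by case: ifP => _; rewrite ?mul1n.
have total : \sum_(u in E) w u * (2 * dom u + w u) = S * S.
  have -> : S * S = \sum_(u in E) \sum_(x in E) w u * w x.
    by rewrite /S big_distrlr.
  pose A := \sum_(u in E) \sum_(x in E) ((x != u) && D x u) * (w u * w x).
  have A_E : A = \sum_(u in E) \sum_(x in E) ((x != u) && D u x) * (w u * w x).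
    rewrite /A exchange_big /=; apply: eq_bigr => u _; apply: eq_bigr => x _.
    by rewrite eq_sym (mulnC (w x)).
  transitivity (A + A + \sum_(u in E) \sum_(x in E) (x == u) * (w u * w x)).
    rewrite {1}/A -big_split -big_split /=; apply: eq_bigr => u uE.
    have -> : \sum_(x in E) (x == u) * (w u * w x) = w u * w u.
      rewrite (bigD1 u) //= eqxx mul1n big1 ?addn0 // => x /andP[_ /negPf->].
      by rewrite mul0n.
    have -> : \sum_(x in E) ((x != u) && D x u) * (w u * w x) = w u * dom u.
      by rewrite domE big_distrr /=; apply: eq_bigr => x _; rewrite mulnCA.
    by lia.
  rewrite {2}A_E /A -big_split -big_split /=; apply: eq_bigr => u _.
  rewrite -big_split -big_split /=; apply: eq_bigr => x _.
  have [->|xu] := eqVneq x u; first by rewrite !mul0n mul1n.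
  by rewrite (Dtot x u xu); case: (D u x); rewrite !(mul0n, mul1n, addn0).
case: (pickP [pred u | (u \in E) && (S <= 2 * dom u + w u)]) => [u|none].
  by case/andP=> uE uS; exists u.
suff : S * S < S * S by rewrite ltnn.
rewrite -{1}total {1}/S big_distrl /=.
have lt u : u \in E -> w u * (2 * dom u + w u) < w u * S.
  by move=> uE; have := none u; rewrite /= uE /= => /negbT; rewrite -ltnNge ltn_pmul2l.
rewrite (bigD1 u0) //= [X in _ < X](bigD1 u0) //= -addSn leq_add ?lt //.
by apply: leq_sum => u /andP[uE _]; apply/ltnW/lt.
Qed.

(* Greedily adding popular vertices to [P] shrinks the total weight
   [2 ^ (m - degree)] of the deficient vertices by a factor 3/4 each time, and
   the initial weight is at most [2 ^ (m + l)]. *)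
Lemma tournament_multi_domination (W : finType) (D : rel W) (U : {set W})
    (m l : nat) :
  (forall x y, x != y -> D x y = ~~ D y x) -> 0 < m -> #|U| <= 2 ^ l ->
  exists P : {set W}, [/\ P \subset U, #|P| <= 3 * (m + l) &
    forall x, x \in U -> x \notin P -> m <= #|[set y in P | D x y]|].
Proof.
move=> Dtot m_gt0 cardU.
pose deg x (P : {set W}) := #|[set y in P | D x y]|.
pose deficient (P : {set W}) := [set x in U | (x \notin P) && (deg x P < m)].
pose pot (P : {set W}) := \sum_(x in deficient P) 2 ^ (m - deg x P).
have step r : exists P : {set W},
    [/\ P \subset U, #|P| <= r & 4 ^ r * pot P <= 3 ^ r * 2 ^ (m + l)].
  elim: r => [|r [P [PU cardP potP]]].
    exists set0; split; rewrite ?sub0set ?cards0 // !mul1n.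
    apply: leq_trans (_ : #|U| * 2 ^ m <= _); last first.
      by rewrite expnD mulnC leq_mul2l cardU orbT.
    rewrite -sum_nat_const /pot big_mkcond [X in _ <= X]big_mkcond /=.
    apply: leq_sum => x _; rewrite inE; case: (x \in U) => //=.
    by case: ifP => // _; rewrite leq_exp2l // leq_subr.
  have [E0|E_gt0] := posnP #|deficient P|.
    exists P; split=> //; first exact: leqW.
    by rewrite /pot (cards0_eq E0) big_set0 muln0.
  have [|u uE uS] := @weighted_popular_vertex _ D (deficient P)
    (fun x => 2 ^ (m - deg x P)) Dtot _ E_gt0.
    by move=> x; rewrite expn_gt0.
  have /and3P[uU uP udeg] : [&& u \in U, u \notin P & deg u P < m].
    by move: uE; rewrite inE.
  exists (u |: P); split.
  - by rewrite subUset sub1set uU.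
  - by rewrite cardsU1 uP.
  have degS x : deg x (u |: P) = D x u + deg x P.
    rewrite /deg; have [xu|nxu] := boolP (D x u).
      have -> : [set y in u |: P | D x y] = u |: [set y in P | D x y].
        by apply/setP=> y; rewrite !inE; case: eqP => // ->; rewrite xu.
      by rewrite cardsU1 inE (negPf uP).
    rewrite add0n; apply: eq_card => y; rewrite !inE.
    by case: eqP => // ->; rewrite (negPf nxu) !andbF.
  suff le : 4 * pot (u |: P) <= 3 * pot P.
    rewrite !expnS -!mulnA -(mulnC (pot _)) mulnCA.
    have := leq_mul (leqnn (4 ^ r)) le; move: potP; lia.
  move: uS; rewrite /= -/(pot P).
  set dom := \sum_(x in _ | _) _ => uS.
  have potD : pot P = 2 ^ (m - deg u P) +
      \sum_(x in deficient P | x != u) 2 ^ (m - deg x P).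
    by rewrite /pot (bigD1 u).
  set rest := \sum_(x in _ | x != u) _ in potD.
  (* Each [x] with [D x u] has its weight halved or drops out. As [uS] gives [rest <= 2 * dom], this
     yields the factor 3/4. *)
  suff : 2 * pot (u |: P) + dom <= 2 * rest.
    by move: (pot P) (pot (u |: P)) (2 ^ _) uS potD => p p' wu; lia.
  rewrite /pot /dom /rest !big_distrr /= (big_mkcond _ (fun x => 2 ^ _)).
  rewrite [X in X + _ <= _]big_mkcond [X in _ <= X]big_mkcond /= -big_split /=.
  apply: leq_sum => x _; rewrite !inE negb_or degS.
  case: (x \in U) => //=; case: (x \in P) => /=; first by rewrite andbF.
  case: (x == u) => /=; first by rewrite andbF.
  case: (D x u) => /=; rewrite ?add1n ?add0n; last by case: ifP => //=; rewrite addn0.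
  have [lt1|] := ltnP (deg x P) m; last first.
    by move=> le; rewrite ltnNge (leq_trans le (leqnSn _)).
  have -> : 2 ^ (m - deg x P) = 2 * 2 ^ (m - (deg x P).+1).
    by rewrite -expnS subnSK.
  by case: ifP => _ /=; rewrite ?mul2n -?addnn //; lia.
(* Since 27/64 < 1/2, three rounds outweigh one factor 2; after [3 * (m + l)] rounds the potential
   is below 1, too small for any deficient vertex. *)
have [P [PU cardP potP]] := step (3 * (m + l)); exists P; split=> // x xU xP.
rewrite leqNgt; apply/negP => lt.
have pot_gt0 : 0 < pot P.
  by rewrite /pot (bigD1 x) ?inE ?xU ?xP //= addn_gt0 expn_gt0.
have : 4 ^ (3 * (m + l)) <= 3 ^ (3 * (m + l)) * 2 ^ (m + l).
  by apply: leq_trans potP; rewrite leq_pmulr.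
rewrite !expnM -expnMn leqNgt ltn_exp2r //; lia.
Qed.

(** * Labelling by steered domination *)

(* Levels of even parity use outgoing edges, those of odd parity incoming ones. *)
Definition steered (W : finType) (k : nat) (o : rel W)
    (c : W -> W -> option 'I_k) (i : 'I_k) (j : nat) : rel W :=
  fun x y => (c x y == Some i) && (o x y (+) odd j).

(** Reverse the colours that are odd in [a]. Of [k * q + q] out-neighbours in [P] at most [q] are
    uncoloured, and the other [k * q] fall into [k] colours, so one colour gets [q]. *)
Lemma cell_domination (W : finType) (k q l : nat) (o : rel W)
    (c : W -> W -> option 'I_k) (a : {ffun 'I_k -> nat}) (U : {set W}) :
  (forall x y, x != y -> o x y = ~~ o y x) ->
  (forall x y, c x y = c y x) ->
  (forall x, #|[set y | c x y == None]| <= q) ->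
  0 < k -> 0 < q -> #|W| <= 2 ^ l ->
  exists P : {set W}, [/\ P \subset U, #|P| <= 3 * (k * q + q + l) &
    forall x, x \in U -> x \notin P ->
      exists i, q <= #|[set y in P | steered o c i (a i) x y]|].
Proof.
move=> otot csym twins k_gt0 q_gt0 cardW.
pose D x y := if c x y is Some i then o x y (+) odd (a i) else o x y.
have Dtot x y : x != y -> D x y = ~~ D y x.
  move=> xy; rewrite /D csym; case: (c y x) => [i|]; last exact: otot.
  by rewrite (otot x y xy) addNb.
have [||P [PU cardP domP]] := @tournament_multi_domination W D U (k * q + q) l Dtot.
- by rewrite addn_gt0 q_gt0 orbT.
- exact: leq_trans (max_card _) cardW.
exists P; split=> // x xU xP; apply/existsP; rewrite -[X in is_true X]negbK.
apply/negP => /existsPn few.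
have cover : [set y in P | D x y] \subset [set y | c x y == None] :|:
    \bigcup_(i < k) [set y in P | steered o c i (a i) x y].
  apply/subsetP => y; rewrite !inE => /andP[yP]; rewrite /D.
  case cxy: (c x y) => [i|] //= dir.
  by apply/bigcupP; exists i; rewrite // inE yP /steered cxy eqxx.
have := leq_trans (domP x xU xP) (subset_leq_card cover); apply/negP.
rewrite -ltnNge; apply: leq_ltn_trans (leq_card_setU _ _) _.
rewrite addnC -addSn leq_add //.
apply: leq_ltn_trans (_ : \sum_(i < k) q.-1 < _); last first.
  by rewrite sum_nat_const card_ord ltn_pmul2l // prednK.
apply: leq_trans (_ : \sum_(i < k) #|[set y in P | steered o c i (a i) x y]| <= _).
  elim/big_rec2: _ => [|i u v _ le]; first by rewrite cards0.
  by apply: leq_trans (leq_card_setU _ _) _; rewrite leq_add2l.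
by apply: leq_sum => i _; rewrite -ltnS prednK // ltnNge.
Qed.

(* At stage [s] all cells of labels with coordinate sum [s] are treated at
   once; the core kept in a cell never moves again. *)
Lemma steered_labelling (W : finType) (k q l M : nat) (o : rel W)
    (c : W -> W -> option 'I_k) :
  (forall x y, x != y -> o x y = ~~ o y x) ->
  (forall x y, c x y = c y x) ->
  (forall x, #|[set y | c x y == None]| <= q) ->
  0 < k -> 0 < q -> #|W| <= 2 ^ l ->
  exists lab : W -> {ffun 'I_k -> nat}, [/\ forall x i, lab x i <= M,
    forall x i j, j < lab x i ->
      q <= #|[set y | (lab y i == j) && steered o c i j x y]| &
    forall a : {ffun 'I_k -> nat}, (forall i, a i < M) ->
      #|[set x | lab x == a]| <= 3 * (k * q + q + l)].
Proof.
move=> otot csym twins k_gt0 q_gt0 cardW.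
pose inner (a : {ffun 'I_k -> nat}) := [forall i, a i < M].
pose height (a : {ffun 'I_k -> nat}) := \sum_i a i.
pose bound := 3 * (k * q + q + l).
(* Only vertices with [final] labels are counted towards [q]: later moves start from height at least
   [s], so these labels never change. *)
pose final s (a : {ffun 'I_k -> nat}) := inner a && (height a < s).
suff stage s : exists lab : W -> {ffun 'I_k -> nat},
    [/\ forall x i, lab x i <= M,
      forall x, inner (lab x) -> height (lab x) <= s,
      forall x i j, j < lab x i -> q <= #|[set y |
        [&& final s (lab y), lab y i == j & steered o c i j x y]]| &
      forall a, final s a -> #|[set x | lab x == a]| <= bound].
  have [lab [labM _ labq labc]] := stage (k * M).+1.
  exists lab; split=> // [x i j jx|a a_lt].
    apply: leq_trans (labq x i j jx) _; apply/subset_leq_card/subsetP => y.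
    by rewrite !inE => /andP[].
  apply: labc; apply/andP; split; first exact/forallP.
  rewrite ltnS -[k in k * _]card_ord -sum_nat_const.
  by apply: leq_sum => i _; apply: ltnW.
elim: s => [|s [lab [labM labs labq labc]]].
  exists (fun=> [ffun=> 0]); split=> [x i|x _|x i j|a].
  - by rewrite ffunE.
  - by rewrite /height big1 // => i _; rewrite ffunE.
  - by rewrite ffunE.
  - by rewrite /final ltn0 andbF.
pose up (a : {ffun 'I_k -> nat}) i : {ffun 'I_k -> nat} :=
  [ffun h => a h + (h == i)].
pose dominates a (P : {set W}) i x :=
  q <= #|[set y in P | steered o c i (a i) x y]|.
pose good (a : {ffun 'I_k -> nat}) (P : {set W}) :=
  [&& P \subset [set x | lab x == a], #|P| <= bound &
    [forall x, (lab x == a) ==> (x \notin P) ==> [exists i, dominates a P i x]]].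
pose core a := odflt set0 [pick P | good a P].
have core_good a : good a (core a).
  rewrite /core; case: pickP => //= none.
  have [P [PU cardP domP]] :=
    @cell_domination W k q l o c a [set x | lab x == a] otot csym twins k_gt0 q_gt0 cardW.
  have /negP[] := none P; apply/and3P; split=> //.
  apply/forallP=> x; apply/implyP=> xa; apply/implyP=> xP; apply/existsP.
  by apply: domP; rewrite ?inE.
have coreP x y : y \in core (lab x) -> lab y = lab x.
  by case/and3P: (core_good (lab x)) => /subsetP sub _ _ /sub; rewrite inE => /eqP.
pose moved x := [&& inner (lab x), height (lab x) == s & x \notin core (lab x)].
(* The inner fallback is never reached: a moved vertex lies outside its core, hence is dominated in
   some colour. *)
pose lab' x := if moved x then
  if [pick i | dominates (lab x) (core (lab x)) i x] is Some i then up (lab x) i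
  else lab x else lab x.
have stay x : ~~ moved x -> lab' x = lab x by rewrite /lab' => /negPf->.
have move_up x : moved x ->
    exists2 i, dominates (lab x) (core (lab x)) i x & lab' x = up (lab x) i.
  move=> mx; rewrite /lab' mx; case: pickP => [i di|none]; first by exists i.
  case/and3P: mx => _ _ xP; case/and3P: (core_good (lab x)) => _ _ /forallP/(_ x).
  by rewrite eqxx xP /= => /existsP[i]; rewrite none.
have height_up a i : height (up a i) = (height a).+1.
  rewrite /height (eq_bigr (fun h => a h + (h == i))) => [|h _]; last by rewrite ffunE.
  rewrite big_split /= -addn1; congr (_ + _).
  by rewrite (bigD1 i) //= eqxx big1 // => h /negPf->.
have height_moved x : moved x -> height (lab' x) = s.+1.
  move=> mx; have [i _ ->] := move_up x mx; rewrite height_up.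
  by case/and3P: mx => _ /eqP->.
exists lab'; split.
- move=> x h; have [mx|/stay->] := boolP (moved x); last exact: labM.
  have [i _ ->] := move_up x mx; rewrite ffunE.
  case/and3P: mx => /forallP/(_ h) lt _ _; case: (h == i); rewrite /= ?addn1 ?addn0 // ltnW.
- move=> x; have [mx|/stay->] := boolP (moved x); first by rewrite height_moved.
  by move/labs/leqW.
- move=> x i j jx; have [jx'|xj] := ltnP j (lab x i).
    apply: leq_trans (labq x i j jx') _; apply/subset_leq_card/subsetP => y.
    rewrite !inE => /and3P[/andP[iny hy] yj st].
    rewrite stay; first by rewrite yj st /final iny ltnS ltnW.
    by rewrite /moved (ltn_eqF hy) andbF.
  (* The only new level is [j = lab x i]; its witnesses are the core of the old cell, which stays
     put and becomes final. *)
  have mx : moved x by apply/negPn/negP => /stay E; move: jx; rewrite E ltnNge xj.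
  have [h dh Eh] := move_up x mx; move: jx; rewrite Eh ffunE.
  case: eqP => [ih|_]; last by rewrite addn0 ltnNge xj.
  rewrite addn1 ltnS => jx; have {xj jx}-> : j = lab x i.
    by apply/eqP; rewrite eqn_leq jx.
  rewrite -ih in dh; apply: leq_trans dh _; apply/subset_leq_card/subsetP => y.
  rewrite !inE => /andP[yP st]; have Ey := coreP x y yP.
  have -> : lab' y = lab x by rewrite stay // /moved Ey yP !andbF.
  by case/and3P: mx => inx /eqP hx _; rewrite /final inx hx ltnSn eqxx.
- move=> a /andP[ina]; rewrite ltnS leq_eqVlt => ha.
  (* Moved vertices land at height [s.+1], so none enters a cell of height at most [s], and cells of
     height [s] shrink to their cores. *)
  have small x : lab' x = a -> lab x = a /\ ~~ moved x.
    move=> Ex; suff nx : ~~ moved x by rewrite -(stay x nx).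
    apply/negP => /height_moved; rewrite Ex => E.
    by move: ha; rewrite E; lia.
  case/orP: ha => ha.
    case/and3P: (core_good a) => _ cardP _; apply: leq_trans cardP.
    apply/subset_leq_card/subsetP => x; rewrite inE => /eqP/small[Ex].
    by rewrite /moved Ex ina ha negbK.
  apply: leq_trans (labc a _); last by rewrite /final ina ha.
  by apply/subset_leq_card/subsetP => x; rewrite !inE => /eqP/small[->].
Qed.

(** * Growing and embedding oriented trees *)

(** Connectivity gives an edge leaving any proper nonempty set; if the set is connected, a second
    neighbour of the new vertex inside it would close a cycle. *)
Lemma oriented_tree_ind (V : finType) (e : rel V) (Q : {set V} -> Prop) :
  oriented_tree e ->
  (forall x, Q [set x]) ->
  (forall (S : {set V}) x y, Q S -> x \in S -> y \notin S -> undirected e x y ->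
     (forall z, z \in S -> undirected e z y -> z = x) -> Q (y |: S)) ->
  Q [set: V].
Proof.
case=> _ /card_gt0P[x0 _] conn acyc Q1 QS.
have usym x y : undirected e x y = undirected e y x by rewrite /undirected orbC.
pose within (S : {set V}) x y := [&& x \in S, y \in S & undirected e x y].
have wsym S x y : within S x y = within S y x by rewrite /within usym andbCA.
have wmono S y x z : connect (within S) x z -> connect (within (y |: S)) x z.
  apply: connect_sub => u v /and3P[uS vS uv]; apply: connect1.
  by rewrite /within !in_setU1 uS vS uv !orbT.
suff grow r S : #|~: S| <= r -> S != set0 -> Q S ->
    {in S &, forall x y, connect (within S) x y} -> Q [set: V].
  apply: (grow _ [set x0] (leqnn _)) => [||x y]; first by apply/set0Pn; exists x0; rewrite inE.
    exact: Q1.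
  by rewrite !inE => /eqP-> /eqP->.
elim: r S => [|r IH] S cardS /set0Pn[x1 x1S] QS' connS.
  suff <- : S = setT by [].
  by apply/setP => x; move: cardS; rewrite leqn0 cards_eq0 => /eqP/setP/(_ x);
     rewrite !inE => /negbFE.
case: (pickP [pred p : V * V | [&& p.1 \in S, p.2 \notin S & undirected e p.1 p.2]]).
  case=> x y /= /and3P[xS yS xy].
  apply: (IH (y |: S)).
  - rewrite -ltnS; apply: leq_trans cardS; apply: proper_card; apply/properP; split.
      by apply/subsetP=> z; rewrite !inE negb_or => /andP[].
    by exists y; rewrite !inE ?eqxx.
  - by apply/set0Pn; exists y; rewrite !inE eqxx.
  - apply: (QS S x y) => // z zS zy; apply/eqP/negPn/negP => zx.
    have /connectP[p0 p0path Ez] := connS x z xS zS.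
    case/shortenP: p0path Ez => p ppath puniq _ Ez.
    have inS w : w \in x :: p -> w \in S.
      rewrite inE => /predU1P[->//|wp].
      by case/splitPr: wp ppath => p1 p2; rewrite cat_path => /and3P[_ /and3P[]].
    have /negP[] : ~~ ucycleb (undirected e) [:: y, x & p].
      apply: acyc; case: p {ppath puniq inS} Ez => //= Ez.
      by rewrite Ez eqxx in zx.
    rewrite /ucycleb; apply/andP; split; last first.
      by rewrite cons_uniq puniq andbT; apply/negP => /inS; apply/negP.
    rewrite /= rcons_path -Ez zy andbT usym xy /=.
    by apply: sub_path ppath => u v /and3P[].
  move=> u v; rewrite !in_setU1.
  have cyx : connect (within (y |: S)) y x.
    by apply: connect1; rewrite /within !in_setU1 eqxx xS orbT usym.
  have toy w : w \in S -> connect (within (y |: S)) y w.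
    by move=> wS; apply: connect_trans cyx _; apply/wmono/connS.
  have cs : connect_sym (within (y |: S)).
    by apply: sym_connect_sym; apply: wsym.
  case/predU1P=> [->|uS] /predU1P[->|vS] //.
  - exact: toy.
  - by rewrite cs; apply: toy.
  - by apply/wmono/connS.
move=> none; suff <- : S = setT by [].
have cl : closed (undirected e) (mem S).
  apply: intro_closed; first by apply: sym_connect_sym.
  move=> x y xy xS; apply/negPn/negP => yS.
  by have := none (x, y); rewrite /= xS yS xy.
apply/setP=> x; rewrite inE; have := closed_connect cl (conn x1 x).
by rewrite /= x1S => <-.
Qed.

(** Double counting: each of the [#|A| * #|Y|] points over [A] lies in at most one level, and a full
    level uses [#|Y|] of them. *)
Lemma card_full_levels (X Y : finType) (L : nat) (h : X * Y -> nat) (A : {set X}) :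
  0 < #|Y| ->
  #|[set b : 'I_L | #|Y| <= #|[set z | (z.1 \in A) && (h z == b)]|]| <= #|A|.
Proof.
move=> Y_gt0; set B := [set b | _].
rewrite -(leq_pmul2r Y_gt0) -sum_nat_const.
apply: leq_trans (_ : \sum_(b in B) #|[set z | (z.1 \in A) && (h z == b)]| <= _).
  by apply: leq_sum => b; rewrite inE.
have -> : #|A| * #|Y| = \sum_(z : X * Y | z.1 \in A) 1.
  rewrite -cardsT -cardsX -sum1_card; apply: eq_bigl => z.
  by rewrite !inE andbT.
under eq_bigr => b _ do rewrite -sum1_card.
rewrite (exchange_big_dep (fun z => z.1 \in A)) /=; last first.
  by move=> b z _; rewrite inE => /andP[].
apply: leq_sum => z zA; rewrite sum1_card.
apply/card_le1_eqP => b b' /andP[_ +] /andP[_].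
by rewrite !inE => /andP[_ /eqP E] /andP[_ /eqP E']; apply/val_inj; rewrite /= -E -E'.
Qed.

(* [Y] indexes the twins of a vertex of [X]. Levels [2b] and [2b + 1] are taken
   together, so that both edge directions are available at each [b]. A value
   of [b] is [free] when the vertices already used do not have [#|Y|] twins
   there; below every current level at least one free value remains because
   fewer than half of the [2 #|V| + 1] values are full and fewer than half have
   been consumed. *)
Lemma levelled_tree_embedding (V X Y : finType) (e : rel V) (r : rel X)
    (f : X * Y -> nat) (w : X * Y) :
  oriented_tree e ->
  (forall x j, j < f x -> #|Y| <=
     #|[set y | (f y == j) && (if odd j then r y.1 x.1 else r x.1 y.1)]|) ->
  4 * #|V| + 2 <= f w ->
  exists g : V -> X, injective g /\ forall u v, e u v -> r (g u) (g v).
Proof.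
move=> tree down fw.
have Y_gt0 : 0 < #|Y| by apply/card_gt0P; exists w.2.
have [[irr anti] _ _ _] := tree.
pose L := (2 * #|V|).+1.
pose fiber (A : {set X}) b := [set z : X * Y | (z.1 \in A) && ((f z)./2 == b)].
pose free A (b : 'I_L) := #|fiber A b| < #|Y|.
pose base (g : V -> X * Y) (S : {set V}) := [set (g v).1 | v in S].
(* Each new vertex lowers [s] past full values and just one free value, hence the last bound. *)
suff : exists g s, [/\ {in [set: V] &, injective (fun v => (g v).1)},
      {in [set: V] &, forall u v, e u v -> r (g u).1 (g v).1},
      {in [set: V], forall v, s.*2 <= f (g v)} &
      #|[set b : 'I_L | (s <= b) && free (base g [set: V]) b]| <= #|[set: V]|].
  case=> g [s [ginj ge _ _]]; exists (fun v => (g v).1); split=> [u v|u v].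
    by apply: ginj; rewrite inE.
  by apply: ge; rewrite inE.
apply: (oriented_tree_ind tree (Q := fun S => exists g s,
   [/\ {in S &, injective (fun v => (g v).1)},
      {in S &, forall u v, e u v -> r (g u).1 (g v).1},
      {in S, forall v, s.*2 <= f (g v)} &
      #|[set b : 'I_L | (s <= b) && free (base g S) b]| <= #|S|])) => //.
  (* [4 * #|V| + 2] equals [2 * L], so the root can start with every value still below [s = L]. *)
  move=> x; exists (fun=> w), L; split.
  - by move=> u v; rewrite !inE => /eqP-> /eqP->.
  - by move=> u v; rewrite !inE => /eqP-> /eqP->; rewrite (negPf (irr x)).
  - by move=> v _; apply: leq_trans fw; rewrite /L; lia.
  - rewrite eq_card0 // => b; rewrite !inE; apply/negP => /andP[le _].
    by have := ltn_ord b; rewrite ltnNge le.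
move=> S x y [g [s [ginj ge gs cardfree]]] xS yS xy uniq.
(* At most [#|S|] values are full and at most [#|S|] free ones are not below [s]: fewer than [L] in
   all. *)
have [b0 /andP[b0s b0free]] : exists b : 'I_L, (b < s) && free (base g S) b.
  apply/existsP; rewrite -[X in is_true X]negbK; apply/negP => /existsPn none.
  have := @card_full_levels X Y L (fun z => (f z)./2) (base g S) Y_gt0.
  set full := [set b | _] => cardfull.
  have cover : [set: 'I_L] \subset
      full :|: [set b : 'I_L | (s <= b) && free (base g S) b].
    apply/subsetP => b _; rewrite !inE; have := none b.
    have [_|/negPf fb _] := boolP (free (base g S) b).
      by rewrite andbT -leqNgt => ->; rewrite orbT.
    by apply/orP; left; rewrite leqNgt -/(fiber _ _) -/(free _ b) fb.
  have cardB : #|base g S| <= #|S| by apply: leq_imset_card.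
  have cardS : #|S| <= #|V| by apply: max_card.
  have := leq_trans (subset_leq_card cover) (leq_card_setU _ _).
  rewrite cardsT card_ord => /leq_trans/(_ (leq_add (leq_trans cardfull cardB) cardfree)).
  by rewrite /L; lia.
(* The largest such [b] is the only free value newly counted when [s] drops to [b]. *)
pose isfree (b : 'I_L) := (b < s) && free (base g S) b.
have [|b /andP[bs bfree] bmax] := @arg_maxnP _ b0 isfree val.
  by rewrite /isfree b0s.
pose j := b.*2 + e y x.
have jx : j < f (g x).
  apply: leq_trans (gs x xS); rewrite /j.
  by case: (e y x); rewrite ?addn1 ?addn0 -?doubleS ?ltn_Sdouble ?ltn_double //; lia.
have jb : j./2 = b by rewrite /j addnC half_bit_double.
have oddj : odd j = e y x by rewrite /j oddD odd_double /= oddb.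
(* [down] offers [#|Y|] candidates at level [j]; those over used vertices lie in the fibre of [b],
   which is smaller. *)
have [z /andP[zcand znew]] : exists z, (z \in [set z | (f z == j) &&
     (if odd j then r z.1 (g x).1 else r (g x).1 z.1)]) && (z.1 \notin base g S).
  apply/existsP; rewrite -[X in is_true X]negbK; apply/negP => /existsPn none.
  have := leq_trans bfree (down (g x) j jx); rewrite ltnNge => /negP[].
  apply/subset_leq_card/subsetP => z zc; have := none z; rewrite zc negbK.
  rewrite inE => ->; move: zc; rewrite inE => /andP[/eqP-> _].
  by rewrite jb eqxx.
move: zcand; rewrite inE => /andP[/eqP fz rz].
pose g' v := if v == y then z else g v.
have g'S v : v \in S -> g' v = g v.
  by rewrite /g'; case: eqP => // ->; rewrite (negPf yS).
have g'y : g' y = z by rewrite /g' eqxx.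
have zS v : v \in S -> (g v).1 != z.1.
  by move=> vS; apply: contraNneq znew => <-; apply: imset_f.
have base_sub : base g S \subset base g' (y |: S).
  apply/subsetP=> _ /imsetP[v vS ->]; apply/imsetP; exists v; last by rewrite g'S.
  by rewrite in_setU1 vS orbT.
exists g', b; split.
- move=> u v; rewrite !in_setU1 => /predU1P[->|uS] /predU1P[->|vS] //.
  + by rewrite g'y g'S // => E; have := zS v vS; rewrite E eqxx.
  + by rewrite g'y g'S // => E; have := zS u uS; rewrite E eqxx.
  + by rewrite !g'S //; apply: ginj.
- move=> u v; rewrite !in_setU1 => /predU1P[->|uS] /predU1P[->|vS].
  + by rewrite (negPf (irr y)).
  + move=> yv; rewrite g'y g'S //.
    have Ev : v = x by apply: uniq; rewrite // /undirected yv orbT.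
    by move: rz; rewrite oddj -Ev yv.
  + move=> uy; rewrite g'y g'S //.
    have Eu : u = x by apply: uniq; rewrite // /undirected uy.
    by have := anti u y; rewrite uy /= => /negPf nyu; move: rz; rewrite oddj -Eu nyu.
  + by rewrite !g'S //; apply: ge.
- move=> v; rewrite in_setU1 => /predU1P[->|vS].
    by rewrite g'y fz leq_addr.
  by rewrite g'S //; apply: leq_trans (gs v vS); rewrite leq_double ltnW.
- rewrite cardsU1 yS; apply: leq_trans (leq_add (leqnn 1) cardfree).
  rewrite -[X in X + _](cards1 b); apply: leq_trans (leq_card_setU _ _).
  apply/subset_leq_card/subsetP=> b'; rewrite !inE => /andP[bb' free'].
  have free_b' : free (base g S) b'.
    apply: leq_ltn_trans free'; apply/subset_leq_card/subsetP => v.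
    by rewrite !inE => /andP[/(subsetP base_sub)-> ->].
  rewrite free_b' andbT; case: leqP => [|b's]; rewrite ?orbT // orbF.
  by rewrite -val_eqE eqn_leq bb' andbT; apply: bmax; rewrite /isfree b's.
Qed.

(** * Counting labels and the final bound *)

Lemma card_by_label (W : finType) (k M B : nat) (lab : W -> {ffun 'I_k -> nat}) :
  (forall x i, lab x i < M) ->
  (forall a : {ffun 'I_k -> nat}, (forall i, a i < M) -> #|[set x | lab x == a]| <= B) ->
  #|W| <= M ^ k * B.
Proof.
move=> labM cells; pose code x : {ffun 'I_k -> 'I_M} := [ffun i => Ordinal (labM x i)].
rewrite -sum1_card (partition_big code xpredT) //=.
apply: leq_trans (_ : \sum_(phi : {ffun 'I_k -> 'I_M}) B <= _); last first.
  by rewrite sum_nat_const card_ffun !card_ord.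
apply: leq_sum => phi _; rewrite sum1_card.
have phiM i : [ffun i => val (phi i)] i < M by rewrite ffunE ltn_ord.
apply: leq_trans (cells _ phiM).
apply/subset_leq_card/subsetP => x xphi; rewrite inE.
have {xphi} <- : code x = phi by apply/eqP.
by apply/eqP/ffunP=> i; rewrite !ffunE.
Qed.

Theorem theorem1 :
  forall k : nat, 1 <= k ->
  exists c : nat,
    forall (V : finType) (e : rel V), oriented_tree e ->
      RT_le e k (c * #|V| ^ k).
Proof.
(* [3 * (k + 3)] is the cell bound for [q = N], [l = N + N], divided by [N]; [6 ^ k] comes from
   [4 * #|V| + 2 <= 6 * #|V|]; the successor makes the last comparison strict. *)
move=> k k_gt0; exists (3 * (k + 3) * 6 ^ k).+1 => V e tree.
have V_gt0 : 0 < #|V| by case: tree.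
set N := _ * _; exists N; split=> // t col [[tirr tanti] ttot].
have N_gt0 : 0 < N by rewrite /N muln_gt0 expn_gt0 V_gt0.
have tE u v : u != v -> t u v = ~~ t v u.
  move=> uv; have := ttot u v uv; have := tanti u v.
  by case: (t u v); case: (t v u).
pose o (x y : 'I_N * 'I_N) := if x.1 == y.1 then x.2 < y.2 else t x.1 y.1.
pose c (x y : 'I_N * 'I_N) := if x.1 == y.1 then None else
  Some (if t x.1 y.1 then col x.1 y.1 else col y.1 x.1).
have otot x y : x != y -> o x y = ~~ o y x.
  rewrite /o [y.1 == _]eq_sym => xy; case: eqVneq => [E|]; last exact: tE.
  rewrite -leqNgt ltn_neqAle andb_idl // => _.
  apply: contraNneq xy => /val_inj E2.
  by rewrite (surjective_pairing x) (surjective_pairing y) E E2.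
have csym x y : c x y = c y x.
  rewrite /c [y.1 == _]eq_sym; case: eqVneq => // xy; rewrite (tE _ _ xy).
  by case: (t y.1 x.1).
have twins x : #|[set y | c x y == None]| <= N.
  apply: leq_trans (_ : #|setX [set x.1] [set: 'I_N]| <= _); last first.
    by rewrite cardsX cards1 cardsT card_ord mul1n.
  apply/subset_leq_card/subsetP => y; rewrite !inE andbT /c [x.1 == _]eq_sym.
  by case: (y.1 == x.1).
(* This crude bound on the logarithm suffices, being linear in the multiplicity [N]. *)
have cardW : #|{: 'I_N * 'I_N}| <= 2 ^ (N + N).
  by rewrite card_prod card_ord expnD leq_mul // ltnW // ltn_expl.
have [lab [_ labq labc]] :=
  steered_labelling (4 * #|V| + 2) otot csym twins k_gt0 N_gt0 cardW.
case: (pickP [pred p | 4 * #|V| + 2 <= lab p.1 p.2]) => [[w i] /= top|low].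
  pose r u v := t u v && (col u v == i).
  have [|g [ginj ge]] := @levelled_tree_embedding _ _ _ e r (lab^~ i) w tree _ top.
    move=> x j jx; rewrite card_ord; apply: leq_trans (labq x i j jx) _.
    apply/subset_leq_card/subsetP => y; rewrite !inE => /andP[->].
    rewrite /steered /c /o /r; case: (eqVneq x.1 y.1) => // xy; rewrite (tE _ _ xy).
    by case: (t y.1 x.1); case: (odd j) => /andP[/eqP[<-]] //= _; rewrite eqxx.
  exists i, g; split=> // u v /ge /andP[tuv /eqP]; by split.
have labM x i : lab x i < 4 * #|V| + 2.
  by rewrite ltnNge; apply/negbT/(low (x, i)).
have := card_by_label labM labc; rewrite card_prod card_ord leqNgt => /negP[].
have -> : 3 * (k * N + N + (N + N)) = 3 * (k + 3) * N by lia.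
have le6 : (4 * #|V| + 2) ^ k <= 6 ^ k * #|V| ^ k.
  by rewrite -expnMn leq_exp2r //; lia.
have EN : N = #|V| ^ k + 3 * (k + 3) * (6 ^ k * #|V| ^ k).
  by rewrite mulnA -mulSn.
rewrite mulnA ltn_pmul2r // EN mulnC -[X in X < _]add0n -addSn.
by rewrite leq_add ?expn_gt0 ?V_gt0 // leq_mul2l le6 orbT.
Qed.
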